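(* Let $\mathcal{H}=\ell^2(\mathbb{N})$, the real Hilbert space of sequences $x=(x_0,x_1,x_2,\dots)$ with $\sum_{i=0}^\infty x_i^2<\infty$ and inner product $\langle x,y\rangle=\sum_{i=0}^\infty x_iy_i$. For $x\in\mathcal{H}$ write $x_{\ge1}=(0,x_1,x_2,\dots)\in\mathcal{H}$. Then the cone $$\mathcal{C}=\{x\in\mathcal{H}:\ |x_{\ge1}|\le x_0\}$$ is perfect in $\mathcal{H}$.
   Context: $|\cdot|$ is the norm of $\mathcal{H}$. In a real Hilbert space $\mathcal{H}$, a cone is a subset $\mathcal{C}$ that is convex and contains the origin, i.e. $\alpha x+\beta y\in\mathcal{C}$ for all $x,y\in\mathcal{C}$ and $\alpha,\beta\ge 0$. It is pointed if $\mathcal{C}\cap(-\mathcal{C})=\{0\}$. Write $x\preceq y$ if $y-x\in\mathcal{C}$. $\overline{\mathrm{span}}$ denotes the closed linear span. The dual cone of a cone $\mathcal{K}$ is taken within its closed linear span: $\mathcal{K}^\vee=\{x\in\overline{\mathrm{span}}\,\mathcal{K}:\langle x,y\rangle\ge 0\ \forall y\in\mathcal{K}\}$. A face of a closed and pointed cone $\mathcal{C}$ is a subset $\mathcal{F}\subset\mathcal{C}$ which is a cone and satisfies: if $0\preceq x\preceq y$ and $y\in\mathcal{F}$, then $x\in\mathcal{F}$. A (closed and pointed) cone $\mathcal{C}$ is perfect if every face $\mathcal{F}$ of $\mathcal{C}$ satisfies: (1) $\mathcal{F}^\vee=\mathcal{F}$; (2) $\mathcal{F}$ has nonempty interior with respect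 to $\overline{\mathrm{span}}\,\mathcal{F}$. *)

(* Defs.v *)
From HB Require Import structures.
From mathcomp Require Import all_boot all_order all_algebra.
From mathcomp Require Import all_classical all_reals all_analysis.
From mathcomp Require Import ring lra.

Set Implicit Arguments.
Unset Strict Implicit.
Unset Printing Implicit Defensive.

Import Order.TTheory GRing.Theory Num.Theory.
Import numFieldNormedType.Exports.

Local Open Scope classical_set_scope.
Local Open Scope ring_scope.

HB.mixin Record NormedModule_hasInner (R : realType) V & NormedModule R V := {
  inner : V -> V -> R;
  innerC : forall x y, inner x y = inner y x;
  innerDl : forall x y z, inner (x + y) z = inner x z + inner y z;
  innerZl : forall (a : R) x y, inner (a *: x) y = a * inner x y;
  inner_norm : forall x, inner x x = `|x| ^+ 2
}.

#[short(type="hilbertType")]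
HB.structure Definition Hilbert (R : realType) :=
  {V of CompleteNormedModule R V & NormedModule_hasInner R V}.

Section Cones.
Variables (R : realType) (H : hilbertType R).
Implicit Types (C F K : set H) (x y : H).

Definition cone C : Prop :=
  C 0 /\ forall x y (a b : R), C x -> C y -> 0 <= a -> 0 <= b ->
    C (a *: x + b *: y).

Definition pointed C : Prop := C `&` [set - x | x in C] = [set 0].

Definition cone_le C x y : Prop := C (y - x).

Definition linear_span K : set H :=
  [set x | exists (n : nat) (a : 'I_n -> R) (v : 'I_n -> H),
     (forall i, K (v i)) /\ x = \sum_(i < n) a i *: v i].

Definition closed_span K : set H := closure (linear_span K).

Definition dual_cone K : set H :=
  [set x | closed_span K x /\ forall y, K y -> 0 <= inner x y].

Definition face C F : Prop :=
  [/\ F `<=` C, cone F &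
      forall x y, cone_le C 0 x -> cone_le C x y -> F y -> F x].

(* [subspace A] carries the subspace topology on A and is discrete off A; as F
   is included in its closed span, only the former matters here. *)
Definition relative_interior F : set H :=
  interior (F : set (subspace (closed_span F))).

Definition perfect C : Prop :=
  [/\ closed C, cone C, pointed C &
      forall F, face C F -> dual_cone F = F /\ relative_interior F !=set0].

End Cones.

Section SquareSummable.
Variable R : realType.
Implicit Types x y : R^nat.

Definition square_summable : {pred R^nat} :=
  mem [set x : R^nat | cvgn (series (fun i => x i ^+ 2))].

Lemma square_summableP x :
  reflect (cvgn (series (fun i => x i ^+ 2))) (x \in square_summable).
Proof. by apply: (iffP idP) => [/set_mem//|?]; apply: mem_set. Qed.

Lemma square_summable_submod_closed : submod_closed square_summable.
Proof.
split.
  apply/square_summableP; rewrite (_ : (fun _ => _) = 0).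
    have := @is_cvg_seriesZ R 0 0.
    rewrite (_ : series 0 = cst 0); last first.
      by apply/funext => n; rewrite /series/= big1.
    by move=> _; exact: is_cvg_cst.
  by apply/funext => i /=; rewrite expr2 mulr0.
move=> a x y /square_summableP sx /square_summableP sy.
apply/square_summableP.
apply: (@series_le_cvg _ _
    ((2 * a ^+ 2) *: (fun i => x i ^+ 2) + 2 *: (fun i => y i ^+ 2))).
- by move=> i; exact: sqr_ge0.
- move=> i /=; apply: addr_ge0; apply: mulr_ge0 => //; rewrite ?sqr_ge0//.
  by apply: mulr_ge0 => //; exact: sqr_ge0.
- move=> i /=.
  rewrite -[leLHS]/((a * x i + y i) ^+ 2).
  rewrite -[leRHS]/((2 * a ^+ 2) * x i ^+ 2 + 2 * y i ^+ 2).
  have := sqr_ge0 (a * x i - y i); rewrite !expr2; nra.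
- by apply: is_cvg_seriesD; exact: is_cvg_seriesZ.
Qed.

HB.instance Definition _ := GRing.isSubmodClosed.Build R (R^nat)
  square_summable square_summable_submod_closed.

End SquareSummable.

Record l2 (R : realType) := L2 {
  l2_seq :> nat -> R;
  l2_seqP : l2_seq \in @square_summable R
}.

HB.instance Definition _ (R : realType) := [isSub for @l2_seq R].
HB.instance Definition _ (R : realType) := [Choice of l2 R by <:].
HB.instance Definition _ (R : realType) :=
  [SubChoice_isSubLmodule of l2 R by <:].

Section L2Inner.
Variable R : realType.
Implicit Types x y z : l2 R.

Definition l2_inner x y : R := limn (series (fun i => x i * y i)).

Definition l2_norm x : R := Num.sqrt (l2_inner x x).

Lemma l2_ext x y : x =1 y -> x = y.
Proof. by move=> xy; apply/val_inj/funext. Qed.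

Lemma l2DE x y i : (x + y) i = x i + y i. Proof. by []. Qed.
Lemma l2BE x y i : (x - y) i = x i - y i. Proof. by []. Qed.
Lemma l2ZE (a : R) x i : (a *: x) i = a * x i. Proof. by []. Qed.
Lemma l20E i : (0 : l2 R) i = 0. Proof. by []. Qed.

Lemma cvg_l2_sqr x : cvgn (series (fun i => x i ^+ 2)).
Proof. exact/square_summableP/l2_seqP. Qed.

Lemma cvg_l2_inner x y : cvgn (series (fun i => x i * y i)).
Proof.
rewrite (_ : (fun _ => _) = 2^-1 *: ((fun i => (x + y) i ^+ 2)
    - (fun i => x i ^+ 2) - (fun i => y i ^+ 2))).
  have h := cvg_l2_sqr; apply: is_cvg_seriesZ.
  exact: (is_cvg_seriesB (is_cvg_seriesB (h (x + y)) (h x)) (h y)).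
apply/funext => i.
rewrite -[RHS]/(2^-1 * ((x i + y i) ^+ 2 - x i ^+ 2 - y i ^+ 2)).
by field.
Qed.

Lemma l2_innerC x y : l2_inner x y = l2_inner y x.
Proof.
by rewrite /l2_inner; congr (limn (series _)); apply/funext => i; rewrite mulrC.
Qed.

Lemma l2_innerDl x y z : l2_inner (x + y) z = l2_inner x z + l2_inner y z.
Proof.
rewrite /l2_inner -lim_seriesD; [|exact: cvg_l2_inner..].
by congr (limn (series _)); apply/funext => i; rewrite l2DE mulrDl.
Qed.

Lemma l2_innerZl (a : R) x y : l2_inner (a *: x) y = a * l2_inner x y.
Proof.
rewrite /l2_inner -[RHS]/(a *: _) -lim_seriesZ; last exact: cvg_l2_inner.
by congr (limn (series _)); apply/funext => i; rewrite l2ZE -mulrA.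
Qed.

Lemma l2_sum_le x n : \sum_(0 <= i < n) x i ^+ 2 <= l2_inner x x.
Proof.
rewrite /l2_inner (_ : (fun _ => _) = (fun i => x i ^+ 2)); last first.
  by apply/funext => i; rewrite expr2.
apply: (@nondecreasing_cvgn_le _ (series (fun i => x i ^+ 2))).
  by apply: (@nondecreasing_series R _ xpredT) => *; exact: sqr_ge0.
exact: cvg_l2_sqr.
Qed.

Lemma l2_inner_le x (M : R) :
  (forall n, \sum_(0 <= i < n) x i ^+ 2 <= M) -> l2_inner x x <= M.
Proof.
move=> xM; apply: limr_le; first exact: cvg_l2_inner.
apply: nearW => n; rewrite /series/=.
by under eq_bigr do rewrite -expr2; exact: xM.
Qed.

Lemma l2_inner_ge0 x : 0 <= l2_inner x x.
Proof. by have := l2_sum_le x 0; rewrite big_geq. Qed.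

Lemma l2_coord_le x i : x i ^+ 2 <= l2_inner x x.
Proof.
apply: le_trans (l2_sum_le x i.+1); rewrite big_nat_recr//= lerDr.
by apply: sumr_ge0 => *; exact: sqr_ge0.
Qed.

Lemma l2_normK x : l2_norm x ^+ 2 = l2_inner x x.
Proof. by rewrite sqr_sqrtr// l2_inner_ge0. Qed.

Lemma l2_normr0_eq0 x : l2_norm x = 0 -> x = 0.
Proof.
move=> x0; apply: l2_ext => i; rewrite l20E; apply/eqP.
rewrite -(sqrf_eq0 (x i)) eq_le sqr_ge0 andbT.
by have := l2_coord_le x i; rewrite -l2_normK x0 expr0n.
Qed.

Lemma l2_normrZ (a : R) x : l2_norm (a *: x) = `|a| * l2_norm x.
Proof.
rewrite /l2_norm l2_innerZl l2_innerC l2_innerZl mulrA -expr2.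
by rewrite sqrtrM ?sqr_ge0// sqrtr_sqr.
Qed.

Lemma l2_cauchy_schwarz x y : l2_inner x y <= l2_norm x * l2_norm y.
Proof.
have [y0|y0] := eqVneq (l2_norm y) 0.
  rewrite y0 mulr0 (l2_normr0_eq0 y0) l2_innerC -(scale0r x) l2_innerZl.
  by rewrite mul0r.
have yp : 0 < l2_norm y by rewrite lt_def y0 sqrtr_ge0.
have := l2_inner_ge0 (l2_norm y ^+ 2 *: x + (- l2_inner x y) *: y).
rewrite l2_innerDl 2!(l2_innerC _ (_ + _)) !l2_innerDl !l2_innerZl.
rewrite !(l2_innerC _ (_ *: _)) !l2_innerZl (l2_innerC y x) -!l2_normK => h.
have p0 : 0 <= l2_norm x * l2_norm y by rewrite mulr_ge0// sqrtr_ge0.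
have [xy0|xy0] := leP (l2_inner x y) 0; first exact: le_trans xy0 p0.
rewrite -(ler_pXn2r (ltn0Sn 1)) ?nnegrE ?(ltW xy0)//.
rewrite -(ler_pM2l (exprn_gt0 2 yp)) -subr_ge0; apply: le_trans h _.
by rewrite le_eqVlt; apply/orP; left; apply/eqP; ring.
Qed.

Lemma l2_ler_normD x y : l2_norm (x + y) <= l2_norm x + l2_norm y.
Proof.
have s0 : 0 <= l2_norm x + l2_norm y by rewrite addr_ge0// sqrtr_ge0.
rewrite -(ler_pXn2r (ltn0Sn 1)) ?nnegrE ?sqrtr_ge0// l2_normK.
rewrite l2_innerDl 2!(l2_innerC _ (_ + _)) !l2_innerDl (l2_innerC y x).
rewrite -!l2_normK; have := l2_cauchy_schwarz x y; rewrite !expr2; nra.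
Qed.

End L2Inner.

HB.instance Definition _ (R : realType) := Lmodule_isNormed.Build R (l2 R)
  (@l2_ler_normD R) (@l2_normrZ R) (@l2_normr0_eq0 R).

Section L2Complete.
Variable R : realType.
Implicit Types x y : l2 R.

Lemma l2_normE x : `|x| = l2_norm x. Proof. by []. Qed.

Lemma l2_inner_norm x : l2_inner x x = `|x| ^+ 2.
Proof. by rewrite l2_normE l2_normK. Qed.

Lemma l2_coord_norm x i : `|x i| <= `|x|.
Proof.
rewrite -(ler_pXn2r (ltn0Sn 1)) ?nnegrE ?normr_ge0//.
by rewrite real_normK ?num_real// -l2_inner_norm; exact: l2_coord_le.
Qed.

Lemma l2_complete (F : set_system (l2 R)) :
  ProperFilter F -> cauchy F -> cvg F.
Proof.
move=> FF /cauchyP Fc.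
have coordc i : cvg ((fun x : l2 R => x i) @ F).
  apply/cauchy_cvgP/cauchy_exP => e e0.
  have [x Fx] := Fc e e0; exists (x i).
  apply: (@filterS _ F _ (ball x e) [set y : l2 R | ball (x i) e (y i)]) => //.
  move=> y; rewrite -!ball_normE /= => xy.
  exact: le_lt_trans (l2_coord_norm (x - y) i) xy.
pose a : R^nat := fun i => lim ((fun x : l2 R => x i) @ F).
have bnd e : 0 < e -> exists2 x : l2 R, F (ball x e) &
    forall n, \sum_(0 <= i < n) (x i - a i) ^+ 2 <= e ^+ 2.
  move=> e0; have [x Fx] := Fc e e0; exists x => // n.
  have sc : (fun y : l2 R => \sum_(0 <= i < n) (x i - y i) ^+ 2) @ F -->
      \sum_(0 <= i < n) (x i - a i) ^+ 2.
    apply: cvg_big => [|i _]; first exact: add_continuous.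
    by apply: cvgM; (apply: cvgB; [exact: cvg_cst|exact: coordc]).
  apply: (cvgr_to_le sc).
  apply: (filterS _ Fx) => y; rewrite -ball_normE /= => xy.
  apply: le_trans (l2_sum_le (x - y) n) _.
  by rewrite l2_inner_norm ler_pXn2r ?nnegrE ?normr_ge0// ltW.
have sa : a \in @square_summable R.
  have [x _ xa] := bnd 1 ltr01.
  suff sd : (x : R^nat) - a \in @square_summable R.
    by rewrite -(subKr (x : R^nat) a) rpredB// l2_seqP.
  apply/square_summableP/nondecreasing_is_cvgn.
    by apply: (@nondecreasing_series R _ xpredT) => *; exact: sqr_ge0.
  by exists (1 ^+ 2) => _ [n _ <-]; exact: xa.
apply/cvg_ex; exists (L2 sa); apply/cvgrPdist_lt => e e0.
have e20 : 0 < e / 2 by rewrite divr_gt0.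
have [x Fx xa] := bnd _ e20.
have {}xa : `|x - L2 sa| <= e / 2.
  rewrite -(ler_pXn2r (ltn0Sn 1)) ?nnegrE ?normr_ge0 ?(ltW e20)//.
  by rewrite -l2_inner_norm; apply: l2_inner_le => n; exact: xa.
apply: (filterS _ Fx) => y; rewrite -ball_normE /= => xy.
rewrite -(subrK x (L2 sa)) -addrA (le_lt_trans (ler_normD _ _))//.
by rewrite [ltRHS]splitr ler_ltD// distrC.
Qed.

HB.instance Definition _ := Uniform_isComplete.Build (l2 R) l2_complete.

HB.instance Definition _ := NormedModule_hasInner.Build R (l2 R)
  (@l2_innerC R) (@l2_innerDl R) (@l2_innerZl R) l2_inner_norm.

Lemma l2_tail_subproof x :
  (fun i => if i == 0%N then 0 else x i) \in @square_summable R.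
Proof.
apply/square_summableP.
apply: (@series_le_cvg _ _ (fun i => x i ^+ 2)).
- by move=> i; exact: sqr_ge0.
- by move=> i; exact: sqr_ge0.
- by case=> [|i] //=; rewrite expr0n sqr_ge0.
- exact: cvg_l2_sqr.
Qed.

Definition l2_tail x : l2 R := L2 (l2_tail_subproof x).

End L2Complete.

(* Main.v *)
Require Import Defs.
From mathcomp Require Import all_boot all_order all_algebra.
From mathcomp Require Import all_classical all_reals all_analysis.
From mathcomp Require Import ring lra.

(** The proof takes place in an arbitrary real Hilbert space with a unit vector
    [e]; the cone of the theorem is the case [e = (1, 0, 0, ...)].  Write
    [s x = <x, e>] for the height of [x] and [t x] for its component orthogonal
    to [e], so that the cone is [C = {x : |t x| <= s x}].

    A face [F] of [C] is of one of two kinds ([lorentz_faceP]).  If [F] contains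
    a point with [|t u| < s u], every [y] in [C] has a small positive multiple
    below [u], so [F = C].  Otherwise [|t x| = s x] on all of [F]; since [F] is
    stable under addition, any two of its elements satisfy the equality case of
    the triangle inequality for their components [t], which makes them
    proportional: [F] is a ray, possibly reduced to [0].

    The cone [C] is its own dual: Cauchy-Schwarz gives [<x, y> >= 0] on [C], and
    conversely [x] is tested against [|t x| e - t x] and [e]; its interior
    contains [e].  A ray is its own dual within the line it spans, and its
    generator is interior to it relative to that line.  A ray is generated by a
    vector [v] which is either a unit vector or [0], that is, which satisfies
    [<v, v> v = v]; the equation [x = <x, v> v] then describes the closed span
    of the ray, so that all proper faces are treated at once. *)

Set Implicit Arguments.
Unset Strict Implicit.
Unset Printing Implicit Defensive.

Import Order.TTheory GRing.Theory Num.Theory.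
Import numFieldNormedType.Exports.

Local Open Scope classical_set_scope.
Local Open Scope ring_scope.

(** * Inner products *)

Section InnerProduct.
Variables (R : realType) (H : hilbertType R).
Implicit Types x y z : H.

Lemma innerDr x y z : inner x (y + z) = inner x y + inner x z.
Proof. by rewrite innerC innerDl !(innerC x). Qed.

Lemma innerZr (a : R) x y : inner x (a *: y) = a * inner x y.
Proof. by rewrite innerC innerZl (innerC x). Qed.

Lemma innerNl x y : inner (- x) y = - inner x y.
Proof. by rewrite -scaleN1r innerZl mulN1r. Qed.

Lemma innerNr x y : inner x (- y) = - inner x y.
Proof. by rewrite innerC innerNl (innerC x). Qed.

Lemma inner0r x : inner x 0 = 0.
Proof. by rewrite -(scale0r 0) innerZr mul0r. Qed.

Lemma inner_ge0 x : 0 <= inner x x.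
Proof. by rewrite inner_norm exprn_ge0. Qed.

Lemma inner_eq0 x : inner x x = 0 -> x = 0.
Proof. by rewrite inner_norm => /eqP; rewrite sqrf_eq0 normr_eq0 => /eqP. Qed.

Lemma sqr_normD x y : `|x + y| ^+ 2 = `|x| ^+ 2 + 2 * inner x y + `|y| ^+ 2.
Proof. by rewrite -!inner_norm innerDl !innerDr (innerC y x); ring. Qed.

(** As the norm is known to satisfy the triangle inequality, expanding
    [|x + y| ^+ 2 <= (|x| + |y|) ^+ 2] is enough. *)
Lemma cauchy_schwarz x y : inner x y <= `|x| * `|y|.
Proof.
have : `|x + y| ^+ 2 <= (`|x| + `|y|) ^+ 2.
  by rewrite ler_pXn2r ?nnegrE ?addr_ge0 ?normr_ge0 ?ler_normD.
rewrite sqr_normD sqrrD; lra.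
Qed.

(** Equality in the triangle inequality forces equality in Cauchy-Schwarz, since
    both come from the same expansion of the square. *)
Lemma inner_eq_normM x y : `|x + y| = `|x| + `|y| -> inner x y = `|x| * `|y|.
Proof. by move=> xy; have := sqr_normD x y; rewrite xy sqrrD; lra. Qed.

Lemma continuous_inner y : continuous (fun x => inner x y).
Proof.
(* the polarization identity reduces this to the continuity of the norm *)
have -> : (fun x => inner x y) =
    (fun x => 2^-1 * (`|x + y| * `|x + y| - `|x| * `|x| - `|y| * `|y|)).
  by apply/funext => x; rewrite -!expr2 sqr_normD; field.
move=> x; apply: cvgM; first exact: cvg_cst.
have xy : `|z + y| @[z --> x] --> `|x + y|.
  by apply: cvg_norm; apply: cvgD; [exact: cvg_id|exact: cvg_cst].
have xx : `|z| @[z --> x] --> `|x| by apply: cvg_norm; exact: cvg_id.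
by apply: cvgB; [apply: cvgB; apply: cvgM|exact: cvg_cst].
Qed.

End InnerProduct.

(** * Rays *)

Section Cones.
Variables (R : realType) (H : hilbertType R).
Implicit Types (C F K : set H) (x y v : H).

Lemma cone_scale K x (a : R) : cone K -> K x -> 0 <= a -> K (a *: x).
Proof.
by move=> [K0 KD] Kx a0; have := KD _ _ _ _ Kx K0 a0 (lexx 0); rewrite scaler0 addr0.
Qed.

Lemma cone_add K x y : cone K -> K x -> K y -> K (x + y).
Proof.
by move=> [_ KD] Kx Ky; have := KD _ _ _ _ Kx Ky ler01 ler01; rewrite !scale1r.
Qed.

Lemma sub_closed_span K : K `<=` closed_span K.
Proof.
move=> x Kx; apply: subset_closure; exists 1%N, (fun=> 1), (fun=> x).
by rewrite big_ord1 scale1r.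
Qed.

Lemma relative_interiorP K x : K x ->
  (\forall y \near x, closed_span K y -> K y) -> relative_interior K x.
Proof.
move=> Kx nK; rewrite /relative_interior /interior /=.
suff: nbhs_subspace (x : subspace (closed_span K)) K by [].
by rewrite -nbhs_subspace_in//; exact: sub_closed_span.
Qed.

Definition ray v : set H := [set a *: v | a in [set a : R | 0 <= a]].

Section Ray.
Variable v : H.
Hypothesis vv : inner v v *: v = v.

(** The equation cuts out a closed linear subspace, and it contains [v] by the
    normalization of [v]. *)
Lemma closed_span_ray x : closed_span (ray v) x -> x = inner x v *: v.
Proof.
have cl : closed [set y : H | inner y v *: v - y = 0].
  apply: (@closed_comp _ _ (fun y : H => inner y v *: v - y) [set 0]).
    move=> y _; apply: cvgB; last exact: cvg_id.
    by apply: cvgZr_tmp; exact: continuous_inner.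
  exact: accessible_closed_set1 (hausdorff_accessible (@norm_hausdorff _ _)) 0.
suff sub : linear_span (ray v) `<=` [set y : H | inner y v *: v - y = 0].
  by move=> /(closure_subset sub)/cl/subr0_eq.
move=> _ [n [a [w [rw ->]]]] /=; elim/big_ind : _ => [|y z|i _].
- by rewrite innerC inner0r scale0r subr0.
- by move=> /subr0_eq yE /subr0_eq zE; rewrite innerDl scalerDl yE zE subrr.
- have [b _ <-] := rw i.
  by rewrite !innerZl -!scalerA vv subrr.
Qed.

Lemma dual_ray : dual_cone (ray v) = ray v.
Proof.
apply/seteqP; split => x /=.
  move=> [/closed_span_ray xE xv]; rewrite xE; exists (inner x v) => //=.
  by apply: xv; exists 1; rewrite /= ?scale1r.
move=> rx; split; first exact: sub_closed_span.
move: rx => [a /= a0 <-] _ [b /= b0 <-].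
by rewrite innerZl innerZr !mulr_ge0// inner_ge0.
Qed.

Lemma relative_interior_ray : relative_interior (ray v) v.
Proof.
apply: relative_interiorP; first by exists 1; rewrite /= ?scale1r.
have [v0|v0] := eqVneq v 0.
  apply: nearW => y /closed_span_ray ->; exists 0 => //=.
  by rewrite v0 !scaler0.
have vp : 0 < inner v v.
  by rewrite lt_def inner_ge0 andbT; apply: contra_neq v0; exact: inner_eq0.
apply: filterS (cvgr_gt _ (@continuous_inner _ _ v v) _ vp).
by move=> y yv /closed_span_ray ->; exists (inner y v) => //=; exact: ltW.
Qed.

End Ray.

End Cones.

(** * The Lorentz cone of a Hilbert space *)

Section Lorentz.
Variables (R : realType) (H : hilbertType R) (e : H).
Hypothesis ee : inner e e = 1.
Implicit Types (F : set H) (x y v : H).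

Let s x := inner x e.
Let t x := x - inner x e *: e.

Definition lorentz : set H := [set x | `|x - inner x e *: e| <= inner x e].

Let sD x y : s (x + y) = s x + s y. Proof. exact: innerDl. Qed.
Let sZ (a : R) x : s (a *: x) = a * s x. Proof. exact: innerZl. Qed.
Let tD x y : t (x + y) = t x + t y.
Proof. by rewrite /t innerDl scalerDl opprD addrACA. Qed.
Let tZ (a : R) x : t (a *: x) = a *: t x.
Proof. by rewrite /t innerZl scalerBr scalerA. Qed.
Let se : s e = 1. Proof. exact: ee. Qed.
Let te : t e = 0. Proof. by rewrite /t ee scale1r subrr. Qed.
Let sN x : s (- x) = - s x. Proof. by rewrite -scaleN1r sZ mulN1r. Qed.
Let tN x : t (- x) = - t x. Proof. by rewrite -scaleN1r tZ scaleN1r. Qed.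
Let st x : s (t x) = 0.
Proof. by rewrite /s /t innerDl innerNl innerZl ee mulr1 subrr. Qed.
Let tt x : t (t x) = t x. Proof. by rewrite {1}/t [inner _ e]st scale0r subr0. Qed.

Let inner_st x y : inner x y = s x * s y + inner (t x) (t y).
Proof.
rewrite /s /t !(innerDl, innerNl, innerZl, innerDr, innerNr, innerZr) ee.
by rewrite (innerC e y); ring.
Qed.

Let lorentzE x : lorentz x = (`|t x| <= s x). Proof. by []. Qed.

Let lorentz_s_ge0 x : lorentz x -> 0 <= s x.
Proof. by rewrite lorentzE; exact: le_trans. Qed.

Let continuous_slack : continuous (fun x => s x - `|t x|).
Proof.
move=> x; apply: cvgB; first exact: continuous_inner.
apply: cvg_norm; apply: cvgB; first exact: cvg_id.
by apply: cvgZr_tmp; exact: continuous_inner.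
Qed.

Lemma lorentz_closed : closed lorentz.
Proof.
rewrite (_ : lorentz = (fun x => s x - `|t x|) @^-1` [set r | 0 <= r]).
  by apply: closed_comp => [x _|]; [exact: continuous_slack|exact: closed_ge].
by apply/seteqP; split => x /=; rewrite subr_ge0.
Qed.

Lemma lorentz_cone : cone lorentz.
Proof.
split; first by rewrite lorentzE -(scale0r 0) tZ sZ scale0r mul0r normr0.
move=> x y a b; rewrite !lorentzE sD tD !sZ !tZ => Cx Cy a0 b0.
apply: le_trans (ler_normD _ _) _.
by rewrite !normrZ !ger0_norm// lerD// ler_wpM2l.
Qed.

Lemma lorentz_pointed : pointed lorentz.
Proof.
apply/seteqP; split => x; last first.
  move=> ->; split; first by case: lorentz_cone.
  by exists 0; rewrite ?oppr0//; case: lorentz_cone.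
case=> Cx [y Cy xE]; rewrite /= -xE in Cx *.
move: Cx Cy; rewrite !lorentzE sN tN normrN => Cx Cy.
have sy0 : s y = 0 by have := normr_ge0 (t y); lra.
have /eqP : `|t y| = 0 by have := normr_ge0 (t y); lra.
by rewrite normr_eq0 /t [inner y e]sy0 scale0r subr0 => /eqP->; rewrite oppr0.
Qed.

Lemma lorentz_inner_ge0 x y : lorentz x -> lorentz y -> 0 <= inner x y.
Proof.
rewrite !lorentzE => Cx Cy; rewrite inner_st.
have := cauchy_schwarz (- t x) (t y); rewrite innerNl normrN.
have := ler_pM (normr_ge0 _) (normr_ge0 _) Cx Cy; lra.
Qed.

(** Nonnegativity on the cone need only be tested at two points: the second one,
    [e], settles the case [t x = 0], in which the first one degenerates to [0]. *)
Lemma dual_lorentz : dual_cone lorentz = lorentz.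
Proof.
apply/seteqP; split => x; last first.
  by move=> Cx; split=> [|y]; [exact: sub_closed_span|exact: lorentz_inner_ge0].
case=> _ dx; rewrite lorentzE.
have [->|tx0] := eqVneq (`|t x|) 0.
  by apply: dx; rewrite lorentzE te se normr0.
(* the element of the cone whose inner product with [x] is smallest at height [|t x|] *)
have /dx : lorentz (`|t x| *: e - t x).
  by rewrite lorentzE tD tN sD sN tZ sZ te se tt st scaler0 sub0r normrN subr0 mulr1.
rewrite inner_st tD tN sD sN tZ sZ te se tt st scaler0 sub0r innerNr inner_norm.
rewrite subr0 mulr1 expr2 -mulrBl pmulr_lge0 ?subr_ge0//.
by rewrite lt_def tx0 normr_ge0.
Qed.

Lemma relative_interior_lorentz : relative_interior lorentz e.
Proof.
have e0 : 0 < s e - `|t e| by rewrite se te normr0 subr0.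
apply: relative_interiorP; first by rewrite lorentzE -subr_ge0 ltW.
apply: filterS (cvgr_gt _ (@continuous_slack e) _ e0).
by move=> y; rewrite lorentzE subr_gt0 => /ltW.
Qed.

(** An order unit: a small positive multiple of any element of the cone lies
    below a point where the defining inequality is strict. *)
Lemma lorentz_face_full F u : face lorentz F -> F u -> `|t u| < s u -> F = lorentz.
Proof.
move=> [FC Fcone Fface] Fu su; apply/seteqP; split => // y Cy.
have sy := lorentz_s_ge0 Cy.
(* [u - c y] stays in the cone as soon as [2 c s(y) <= s(u) - |t u|]; the [+ 1]
   avoids a division by zero when [y = 0] *)
pose c := (s u - `|t u|) / (2 * (s y + 1)).
have d0 : 0 < 2 * (s y + 1) by lra.
have c0 : 0 < c by rewrite divr_gt0 ?subr_gt0.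
have cE : c * (2 * (s y + 1)) = s u - `|t u| by rewrite divfK ?gt_eqF.
have Fcy : F (c *: y).
  apply: (Fface _ u) => //; rewrite /cone_le.
    by rewrite subr0; apply: cone_scale lorentz_cone Cy _; exact: ltW.
  rewrite lorentzE sD sN tD tN sZ tZ (le_trans (ler_normB _ _))//.
  rewrite normrZ gtr0_norm//.
  have := ler_wpM2l (ltW c0) Cy; rewrite -/(t y) -/(s y); lra.
have := cone_scale Fcone Fcy (ltW (_ : 0 < c^-1)).
by rewrite scalerA mulVf ?gt_eqF// scale1r; apply; rewrite invr_gt0.
Qed.

(** Call [x] isotropic if [|t x| = s x]. Equality in the triangle
    inequality for [t v] and [t x] gives [<x, v> = 2 s(x) s(v)], which is the
    extreme value [|x| |v|]. *)
Lemma isotropic_proportional v x : `|t v| = s v -> `|t x| = s x ->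
  `|t (v + x)| = s (v + x) -> inner v v = 1 -> x = inner x v *: v.
Proof.
rewrite tD sD => tv tx tvx vv.
have /inner_eq_normM tvtx : `|t v + t x| = `|t v| + `|t x| by rewrite tvx tv tx.
have xv : inner x v = 2 * (s v * s x).
  by rewrite innerC inner_st tvtx tv tx; ring.
have xx : inner x x = 2 * s x ^+ 2.
  by rewrite inner_st inner_norm tx; ring.
have sv : 2 * s v ^+ 2 = 1 by move: vv; rewrite inner_st inner_norm tv; lra.
apply/subr0_eq/inner_eq0.
rewrite !(innerDl, innerNl, innerZl, innerDr, innerNr, innerZr) vv (innerC v x).
rewrite xv xx; transitivity (2 * s x ^+ 2 * (1 - 2 * s v ^+ 2)); first by ring.
by rewrite sv subrr mulr0.
Qed.

(** Without a point of strict inequality, the face consists of isotropic vectors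
    whose sums are isotropic, so that it lies on the line of any nonzero element;
    normalizing that element puts it in the form required of the generator of a ray. *)
Lemma lorentz_faceP F : face lorentz F ->
  F = lorentz \/ exists2 v, inner v v *: v = v & F = ray v.
Proof.
move=> faceF; have [FC Fcone _] := faceF.
have [[u [Fu su]]|/forallNP nF] := pselect (exists u, F u /\ `|t u| < s u).
  by left; exact: lorentz_face_full su.
have iso x : F x -> `|t x| = s x.
  move=> Fx; apply: le_anti; apply/andP; split; first exact: FC.
  by rewrite leNgt; apply/negP => tx; apply: (nF x).
right; have [[w [Fw w0]]|/forallNP F0] := pselect (exists w, F w /\ w <> 0); last first.
  exists 0; first by rewrite scaler0.
  apply/seteqP; split => [x Fx|_ [a _ <-]]; last by rewrite scaler0; case: Fcone.
  suff -> : x = 0 by exists 0; rewrite /= ?scaler0.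
  by apply: contrapT => x0; exact: (F0 x).
have nw : `|w| != 0 by rewrite normr_eq0; exact/eqP.
pose v := `|w|^-1 *: w.
have vv : inner v v = 1.
  by rewrite innerZl innerZr inner_norm; field.
have Fv : F v by apply: cone_scale; rewrite // invr_ge0.
exists v; first by rewrite vv scale1r.
apply/seteqP; split => [x Fx|_ [a /= a0 <-]]; last exact: cone_scale.
exists (inner x v); first by apply: lorentz_inner_ge0; exact: FC.
by apply/esym/isotropic_proportional; rewrite // ?iso//; exact: cone_add.
Qed.

Lemma lorentz_perfect : perfect lorentz.
Proof.
split; [exact: lorentz_closed|exact: lorentz_cone|exact: lorentz_pointed|].
move=> F /lorentz_faceP[->|[v vv ->]].
  by split; [exact: dual_lorentz|exists e; exact: relative_interior_lorentz].
by split; [exact: dual_ray|exists v; exact: relative_interior_ray].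
Qed.

End Lorentz.

(** * The first basis vector of the sequence space *)

Section FirstBasisVector.
Variable R : realType.

Lemma delta0_square_summable :
  (fun i : nat => (i == 0)%:R : R) \in @square_summable R.
Proof.
apply/square_summableP.
(* this sequence is the geometric one of ratio [0] *)
rewrite (_ : (fun _ => _) = geometric 1 0).
  by apply: is_cvg_geometric_series; rewrite normr0.
by apply/funext => -[|i] /=; rewrite ?expr0 ?expr1n ?exprS ?mul0r ?mulr0 ?mulr1.
Qed.

Definition l2_delta0 : l2 R := L2 delta0_square_summable.

Lemma inner_l2_delta0 (x : l2 R) : inner x l2_delta0 = x 0%N.
Proof.
apply: cvg_lim => //; rewrite -cvg_shiftS.
rewrite (_ : (fun _ => _) = cst (x 0%N)); first exact: cvg_cst.
apply/funext => n /=; rewrite /series/= big_nat_recl//= mulr1.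
by rewrite big1 ?addr0// => i _; rewrite mulr0.
Qed.

Lemma l2_tailE (x : l2 R) : l2_tail x = x - x 0%N *: l2_delta0.
Proof.
apply: l2_ext => -[|i]; rewrite l2BE l2ZE /= ?mulr1 ?subrr//.
by rewrite mulr0 subr0.
Qed.

End FirstBasisVector.

Theorem proposition5p3 (R : realType) :
  perfect [set x : l2 R | `|l2_tail x| <= x 0%N].
Proof.
rewrite (_ : [set _ | _] = lorentz (l2_delta0 R)).
  by apply: lorentz_perfect; rewrite inner_l2_delta0.
by apply/seteqP; split => x /=; rewrite /lorentz/= inner_l2_delta0 l2_tailE.
Qed.
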